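(* Consider the relay system described in the context. If $b_{\max}=1$ and $\overline{D_R}|_{\overline\alpha\to 0}<\dfrac{1}{p^{det}_S}$, i.e. when cooperation is preferred to non-cooperation, then the delay-optimal dynamic policy, i.e. the dynamic policy minimizing the average transmission delay $\tau=(\overline{q_d}+1)/\lambda_S$, is $$\alpha^{D}_s=\begin{cases}1, & s=(0,N),\\ 0, & \text{otherwise.}\end{cases}$$
   Context: Model. Parameters: detection probabilities $p^{det}_S,p^{det}_R\in(0,1)$; integers $b_{\max}\ge 1$, $K$, $N$ with $b_{\max}\le K$ and $N\ge 2K$; a random variable $\Gamma$ on $\{0,1,\dots,b_{\max}\}$ with $\gamma_m=\Pr\{\Gamma=m\}$ and mean $E(\Gamma)>0$, where $b_{\max}$ is the maximum number of energy units harvested in a slot. A relay R has an infinite data buffer $Q_d$ and an energy buffer $Q_e$ of size $N$. Time is slotted, each slot (the time unit) consisting of two equal subslots. At the beginning of a slot the state is $s=(q_d,q_e)$, with $q_d\in\{0,1,2,\dots\}$ the number of data packets in $Q_d$ and $q_e\in\{0,\dots,N\}$ the number of energy units in $Q_e$. With probability $\alpha_s$ node R chooses the data decoding (DD) mode, and otherwise the energy harvesting (EH) mode. First subslot: the source, which always has a packet, transmits, and the destination detects the packet with probability $p^{det}_S$. In DD mode, if the destination does not detect the packet, the packet is added to $Q_d$ at the end of the first subslot; $q_e$ does not change. In EH mode, $q_d$ does not change and $q_e$ becomes $\min(N,q_e+\Gamma)$; units in excess of $N$ are lost (blocked). The harvested amounts are i.i.d. over slots. Second subslot (using the values after the first subslot):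 if $Q_d$ contains at least one packet and $q_e\ge K$, node R is called active; it transmits the head-of-line packet (first-come first-served), $q_e$ decreases by $K$, and with probability $p^{det}_R$ the transmission succeeds and the packet leaves $Q_d$ (otherwise it stays at the head of line). If R is not active, nothing changes. All random choices (mode choices, detections, harvested amounts) are independent. A dynamic policy is a family $\{\alpha_s\}$ of probabilities $\alpha_s\in[0,1]$, one for each state $s$. Non-cooperation is the policy $\alpha_s=0$ for all $s$, whose average transmission delay is $1/p^{det}_S$. Long-run quantities under a policy. $\overline\alpha=\sum_s p_s\alpha_s$, with $p_s$ the probability of state $s$ at the beginning of a slot, is the average DD probability. $p^a_R$ is the probability that R is active; the source throughput is $\lambda_S=p^{det}_S+p^a_R p^{det}_R$. $\overline{q_d}$ is the (time-)average number of data packets at R, and $\tau=(\overline{q_d}+1)/\lambda_S$ is the average transmission delay. $\overline{D_R}$ is the average system delay of a packet at R (queueing delay plus transmission time, where the transmission time runs from the moment the packet becomes head-of-line until it is successfully transmitted); by Little's law $\overline{q_d}=\overline{D_R}\,\overline\alpha(1-p^{det}_S)$. $\overline{D_R}|_{\overline\alpha\to0}$ is the average system delay at R when the average DD probability $\overline\alpha$ tends to $0$. The description of the displayed inequality as the condition for cooperation to be preferred to non-cooperation rests on the assumption that $\overline{D_R}$ is an increasing convex function of the DD probability. *)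

(* Defs.v *)
From HB Require Import structures.
From mathcomp Require Import all_boot all_order all_algebra.
From mathcomp Require Import all_classical all_reals all_analysis.

Set Implicit Arguments.
Unset Strict Implicit.
Unset Printing Implicit Defensive.

Import Order.TTheory GRing.Theory Num.Theory.
Import numFieldNormedType.Exports.

Local Open Scope classical_set_scope.
Local Open Scope ring_scope.

(* [detS], [detR] are p^det_S, p^det_R; [txcost] is K, the energy spent by one
   transmission of the relay; [ecap] is N, the size of the energy buffer;
   [gamma m] = Pr{Gamma = m}.  Since 1 <= bmax <= K, both K and N are
   naturals. *)
Record relay_system (R : realType) := RelaySystem {
  detS : R;
  detR : R;
  bmax : nat;
  txcost : nat;
  ecap : nat;
  gamma : 'I_bmax.+1 -> R;
  detS_prob : 0 < detS < 1;
  detR_prob : 0 < detR < 1;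
  bmax_ge1 : (1 <= bmax)%N;
  bmax_le_txcost : (bmax <= txcost)%N;
  ecap_ge : (2 * txcost <= ecap)%N;
  gamma_ge0 : forall m, 0 <= gamma m;
  gamma_sum1 : \sum_m gamma m = 1;
  gamma_mean_gt0 : 0 < \sum_(m < bmax.+1) m%:R * gamma m
}.

Section Relay.
Context {R : realType} (S : relay_system R).

(* s = (q_d, q_e) *)
Definition state : Type := (nat * 'I_(ecap S).+1)%type.

(* [a s] is alpha_s, the probability of the data decoding mode in state s *)
Definition policy : Type := state -> R.

Definition is_policy (a : policy) : Prop := forall s, 0 <= a s <= 1.

(* A state together with the packet counts needed to follow each packet:
   [arr] packets have entered Q_d so far (those initially present included)
   and [dep] have left it, so q_d = arr - dep.  Packets are numbered 0, 1, ...
   in their order of arrival; the discipline being first-come first-served,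
   the head-of-line packet is number [dep]. *)
Record config := Config {
  arr : nat;
  dep : nat;
  energy : 'I_(ecap S).+1
}.

Definition qd (c : config) : nat := (arr c - dep c)%N.

Definition state_of (c : config) : state := (qd c, energy c).

Definition init (s : state) : config := Config s.1 0 s.2.

(* The random choices of one slot: (DD mode chosen, destination detects the
   source, value of Gamma, destination detects the relay).  The last two are
   drawn in every slot but only used in EH mode, resp. when R is active. *)
Definition draw : finType := (bool * bool * 'I_(bmax S).+1 * bool)%type.

Definition bern (p : R) (b : bool) : R := if b then p else 1 - p.

Definition draw_prob (a : policy) (s : state) (w : draw) : R :=
  let: (dd, ds, g, dr) := w in
  bern (a s) dd * bern (detS S) ds * gamma g * bern (detR S) dr.

(* configuration after the first subslot *)
Definition mid (c : config) (w : draw) : config :=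
  let: (dd, ds, g, _) := w in
  if dd then
    if ds then c else Config (arr c).+1 (dep c) (energy c)
  else Config (arr c) (dep c) (inord (minn (ecap S) (energy c + g))).

(* to be evaluated after the first subslot *)
Definition active (c : config) : bool :=
  (0 < qd c)%N && (txcost S <= energy c)%N.

(* configuration at the end of the slot *)
Definition next (c : config) (w : draw) : config :=
  let c' := mid c w in
  let: (_, _, _, dr) := w in
  if active c' then
    Config (arr c') (dep c' + dr) (inord (energy c' - txcost S))
  else c'.

(* [expect a r t c] is E[r(C_t, W_t)], where C_t is the configuration at the
   beginning of slot t, W_t the random choices of slot t, and C_0 = c. *)
Fixpoint expect (a : policy) (r : config -> draw -> R) (t : nat) (c : config)
    : R :=
  \sum_(w : draw) draw_prob a (state_of c) w *
    (if t is t'.+1 then expect a r t' (next c w) else r c w).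

(* Long-run average per slot of r(C_t, W_t), from the initial state s0.  The
   upper limit is a limit whenever the latter exists; it gives a meaning to
   the average for every policy, stable or not. *)
Definition longrun (s0 : state) (a : policy) (r : config -> draw -> R)
    : \bar R :=
  limn_esup (fun T : nat =>
    ((\sum_(t < T.+1) expect a r t (init s0)) / T.+1%:R)%:E).

(* p_s *)
Definition state_prob (s0 : state) (a : policy) (s : state) : \bar R :=
  longrun s0 a (fun c _ => (state_of c == s)%:R).

(* \overline\alpha *)
Definition avgDD (s0 : state) (a : policy) : \bar R :=
  \esum_(s in [set: state]) (state_prob s0 a s * (a s)%:E)%E.

(* p^a_R *)
Definition active_prob (s0 : state) (a : policy) : \bar R :=
  longrun s0 a (fun c w => (active (mid c w))%:R).

(* lambda_S *)
Definition throughput (s0 : state) (a : policy) : \bar R :=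
  ((detS S)%:E + active_prob s0 a * (detR S)%:E)%E.

(* \overline{q_d}: within a slot, the queue length is that of [c] during the
   first subslot and that of [mid c w] during the second one. *)
Definition avg_qd (s0 : state) (a : policy) : \bar R :=
  longrun s0 a (fun c w => ((qd c)%:R + (qd (mid c w))%:R) / 2%:R).

(* tau *)
Definition tx_delay (s0 : state) (a : policy) : \bar R :=
  ((avg_qd s0 a + 1) / throughput s0 a)%E.

Definition in_buffer (i : nat) (c : config) : bool := (dep c <= i < arr c)%N.

(* Expected total time, in slots, that packet i spends at R, from its entry
   into Q_d until its successful transmission (0 if it never enters Q_d). *)
Definition sojourn (s0 : state) (a : policy) (i : nat) : \bar R :=
  (\sum_(t <oo) (expect a (fun c w =>
     ((in_buffer i c)%:R + (in_buffer i (mid c w))%:R) / 2%:R)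
     t (init s0))%:E)%E.

(* Probability that packet i ever enters Q_d: the supremum over t of the
   (nondecreasing) probability that it has done so by slot t. *)
Definition enters_prob (s0 : state) (a : policy) (i : nat) : \bar R :=
  ereal_sup (range (fun t : nat =>
    (expect a (fun c _ => (i < arr c)%N%:R) t (init s0))%:E)).

(* \overline{D_R}: average over the packets of their system delay at R.  The
   denominator is n.+1 when infinitely many packets enter Q_d almost surely;
   in general it discards the packets that never exist. *)
Definition relay_delay (s0 : state) (a : policy) : \bar R :=
  limn_esup (fun n : nat =>
    ((\sum_(i < n.+1) sojourn s0 a i) /
     (\sum_(i < n.+1) enters_prob s0 a i))%E).

(* The delay-optimal policy need not be unique (for instance its values at
   states that are never visited are immaterial), so optimality means being
   a minimizer among all dynamic policies. *)
Definition delay_optimal (s0 : state) (a : policy) : Prop :=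
  is_policy a /\
  forall b : policy, is_policy b -> (tx_delay s0 a <= tx_delay s0 b)%E.

Definition alphaD : policy :=
  fun s => if (s.1 == 0%N) && (s.2 == ecap S :> nat) then 1 else 0.

End Relay.

Arguments alphaD {R} S.

(* Main.v *)
(* Write g = Pr{Gamma = 1}, p and q for the detection probabilities of the source
   and of the relay, D for the mean delay of a packet that enters an empty relay
   with a full energy buffer and is then served with harvesting in every slot.

   A delivery rate x = q P(active) costs x / (1 - p) decoding slots and
   x K / (q g) harvesting slots per slot, so x is at most the rate reached when
   no harvested unit is ever blocked.  Every packet spends at least D at the
   relay on average, so the mean queue length is at least D x and the delay tau
   is at least (D x + 1) / (p + x).  This is nonincreasing in x when D p <= 1,
   which follows from the hypothesis since D bounds D_R from below for every
   policy.  The policy alphaD loses no harvested unit and starts every packet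
   with a full energy buffer, so it attains both bounds.

   Each bound is a potential (Lyapunov) function whose one-step drift is compared
   with the cost and telescoped along the trajectory. *)
Require Import Defs.
From HB Require Import structures.
From mathcomp Require Import all_boot all_order all_algebra.
From mathcomp Require Import all_classical all_reals all_analysis.
From mathcomp Require Import ring lra zify.

Import Order.TTheory GRing.Theory Num.Theory.
Import numFieldNormedType.Exports.

Local Open Scope classical_set_scope.
Local Open Scope ring_scope.

(* [phi e + 1/2] is the mean remaining delay, counted from the middle of a slot,
   of a packet that is alone at the relay when [e] units of energy are stored and
   the relay always harvests: half a slot is spent if it is transmitted at once
   and successfully. *)
Lemma attempt_delay_ex (R : realFieldType) (g q : R) (K N : nat) :
  0 < g <= 1 -> 0 < q < 1 -> (0 < K <= N)%N ->
  exists phi : nat -> R,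
    [/\ forall e, (e < K)%N ->
          phi e = 1 + (g * phi e.+1 + (1 - g) * phi e),
        forall e, (K <= e <= N)%N ->
          phi e = (1 - q) *
            (1 + (g * phi (e - K).+1 + (1 - g) * phi (e - K)%N)),
        forall e, (e < N)%N -> phi e.+1 <= phi e &
        forall e, (e <= N)%N -> 0 <= phi e].
Proof.
move=> /andP[g0 g1] /andP[q0 q1] /andP[K0 KN].
have posm a b : 0 <= a -> 0 <= b -> 0 <= (1 - q) * (1 + (g * a + (1 - g) * b)).
  move=> a0 b0; have h1 : 0 <= g * a by apply: mulr_ge0; lra.
  have h2 : 0 <= (1 - g) * b by apply: mulr_ge0; lra.
  by apply: mulr_ge0; lra.
have [gn qn] : g != 0 /\ q != 0 by rewrite !gt_eqF.
(* Induction on the capacity beyond [K]: the levels up to [K] are solved in closed form, and each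
   further level depends on lower ones only, except on itself when [K = 1]. *)
rewrite -(subnKC KN); elim: (N - K)%N => {KN N} [|j [phi [lowE highE mono pos]]].
  (* [K / (q * g)] is the value at an empty buffer: [1 / q] attempts on average, each requiring
     [K / g] slots of harvesting. *)
  pose phi e : R := (1 - q) * (K%:R / (q * g)) + (K - e)%N%:R / g.
  have kk : (1 - q) * (K%:R / (q * g)) + K%:R / g = K%:R / (q * g).
    by field; rewrite gn qn.
  have stepE e : (e < K)%N -> phi e = phi e.+1 + g^-1.
    move=> eK; rewrite /phi -addrA; congr (_ + _).
    by rewrite (_ : K - e = (K - e.+1).+1)%N; [rewrite -natr1; field | lia].
  exists phi; split.
  - by move=> e eK; rewrite (stepE _ eK); field.
  - move=> e; rewrite addn0 => eK; have -> : e = K by lia.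
    rewrite subnn.
    have phi0 : phi 0%N = K%:R / (q * g) by rewrite /phi subn0 kk.
    have phiK : phi K = (1 - q) * phi 0%N by rewrite phi0 /phi subnn mul0r addr0.
    have -> : phi 1%N = phi 0%N - g^-1 by rewrite (stepE 0%N) // addrK.
    by rewrite phiK; field.
  - move=> e; rewrite addn0 => eK; rewrite (stepE e) // lerDl invr_ge0; lra.
  - move=> e _; rewrite /phi addr_ge0 ?mulr_ge0 ?invr_ge0 ?mulr_ge0 ?subr_ge0 //; lra.
set N := (K + j)%N in highE mono pos *; rewrite addnS -/N.
have KN : (K <= N)%N by rewrite /N leq_addr.
have [x [x0 xN xE]] : exists x, [/\ 0 <= x, x <= phi N & x = (1 - q) *
    (1 + (g * (if K == 1%N then x else phi (N.+1 - K).+1)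
          + (1 - g) * phi (N.+1 - K)%N))].
  have NE := highE N; rewrite KN leqnn in NE; have {}NE := NE isT.
  case: (eqVneq K 1%N) => K1.
    rewrite K1 subSS subn0; rewrite K1 in NE.
    have N1 : (N - 1).+1 = N by lia.
    rewrite N1 in NE.
    have m := mono (N - 1)%N; rewrite N1 in m.
    have {}m : phi N <= phi (N - 1)%N by apply: m; lia.
    have p := pos N (leqnn _).
    (* For [K = 1] the unknown also occurs on the right, with coefficient [(1 - q) * g < 1], and the
       linear equation is solved for it. *)
    have den : 0 < 1 - (1 - q) * g by nra.
    exists ((1 - q) * (1 + (1 - g) * phi N) / (1 - (1 - q) * g)); split.
    + apply: divr_ge0; last exact: ltW.
      have := posm 0 (phi N) (lexx _) p; by rewrite mulr0 add0r.
    + have h : 0 <= (1 - q) * ((1 - g) * (phi (N - 1)%N - phi N)).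
        by rewrite !mulr_ge0 ?subr_ge0 // ltW.
      by rewrite ler_pdivrMr //; lra.
    + by field; rewrite gt_eqF.
  exists ((1 - q) * (1 + (g * phi (N.+1 - K).+1 + (1 - g) * phi (N.+1 - K)%N))).
  split => //.
  - have p1 : 0 <= phi (N.+1 - K).+1 by apply: pos; lia.
    have p2 : 0 <= phi (N.+1 - K)%N by apply: pos; lia.
    exact: posm.
  - rewrite NE ler_pM2l; last lra.
    have m1 : phi (N.+1 - K).+1 <= phi (N - K).+1.
      by rewrite subSn //; apply: mono; lia.
    have m2 : phi (N.+1 - K)%N <= phi (N - K)%N.
      by rewrite subSn //; apply: mono; lia.
    by rewrite lerD2l lerD // ler_wpM2l // ?subr_ge0 // ltW.
pose phi' e := if (e <= N)%N then phi e else x.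
have lowP e : (e <= N)%N -> phi' e = phi e by rewrite /phi' => ->.
have phiN : phi' N.+1 = x by rewrite /phi' ltnn.
exists phi'; split.
- move=> e eK; rewrite !lowP; [exact: lowE|lia|lia].
- move=> e /andP[Ke]; rewrite leq_eqVlt => /orP[/eqP ->|eN].
    rewrite phiN (lowP (N.+1 - K)%N); last lia.
    rewrite [in LHS]xE; case: eqVneq => K1; last by rewrite lowP //; lia.
    by rewrite (_ : (N.+1 - K).+1 = N.+1) ?phiN //; lia.
  by rewrite !lowP; [apply: highE; lia|lia|lia|lia].
- move=> e; rewrite ltnS leq_eqVlt => /orP[/eqP ->|eN].
    by rewrite phiN lowP.
  by rewrite !lowP; [apply: mono|lia|lia].
- move=> e; rewrite leq_eqVlt => /orP[/eqP ->|eN]; first by rewrite phiN.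
  by rewrite lowP //; apply: pos.
Qed.

(** * Upper limits of sequences *)

Section UpperLimits.
Context {R : realType}.
Implicit Types (u v : nat -> R) (f : nat -> \bar R).
Local Open Scope ereal_scope.

Lemma limn_esup_le f x n0 :
  (forall n, (n0 <= n)%N -> f n <= x) -> limn_esup f <= x.
Proof.
move=> fx; apply: (@le_trans _ _ (ereal_sup (f @` [set n | (n0 <= n)%N]))).
  apply: ereal_inf_lbound; exists [set n | (n0 <= n)%N] => //.
  by exists n0.
by apply: ge_ereal_sup => _ [n /= /fx + <-].
Qed.

Lemma limn_esup_ge f x n0 :
  (forall n, (n0 <= n)%N -> x <= f n) -> x <= limn_esup f.
Proof.
move=> xf; apply: le_ereal_inf_tmp => _ [V [n1 _ n1V] <-].
apply: (le_trans (xf (maxn n0 n1) (leq_maxl _ _))).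
apply: ereal_sup_ubound; exists (maxn n0 n1) => //.
by apply: n1V => /=; exact: leq_maxr.
Qed.

Lemma limn_esup_lt f x :
  limn_esup f < x -> exists n0, forall n, (n0 <= n)%N -> f n <= x.
Proof.
move=> /ereal_inf_lt[_ [V [n0 _ n0V] <-] Vx]; exists n0 => n n0n.
apply: le_trans (ltW Vx); apply: ereal_sup_ubound; exists n => //.
exact: n0V.
Qed.

Lemma inv_succ_small (C e : R) : (0 < e)%R ->
  exists n0, forall n, (n0 <= n)%N -> (C / n.+1%:R <= e)%R.
Proof.
move=> e0; exists (Num.truncn (`|C| / e)) => n n0n.
rewrite ler_pdivrMr // mulrC -ler_pdivrMr //.
apply: (@le_trans _ _ (`|C| / e)%R); first by rewrite ler_pM2r ?invr_gt0 ?ler_norm.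
apply/ltW; apply: lt_le_trans (truncnS_gt _) _.
by rewrite ler_nat ltnS.
Qed.

Lemma limn_esup_le_vanishing u (x C : R) n0 :
  (forall n, (n0 <= n)%N -> (u n <= x + C / n.+1%:R)%R) ->
  limn_esup (fun n => (u n)%:E) <= x%:E.
Proof.
move=> ux; apply/lee_addgt0Pr => e e0; have [n1 n1e] := inv_succ_small C e e0.
apply: (@limn_esup_le _ _ (maxn n0 n1)) => n; rewrite geq_max => /andP[h0 h1].
by rewrite -EFinD lee_fin (le_trans (ux _ h0)) // lerD2l n1e.
Qed.

Lemma limn_esup_ge_vanishing u (x C : R) :
  (forall n, (x - C / n.+1%:R <= u n)%R) ->
  x%:E <= limn_esup (fun n => (u n)%:E).
Proof.
move=> ux; apply/lee_subgt0Pr => e e0; have [n1 n1e] := inv_succ_small C e e0.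
apply: (@limn_esup_ge _ _ n1) => n h1.
by rewrite -EFinB lee_fin (le_trans _ (ux _)) // lerD2l lerN2 n1e.
Qed.

(** An upper limit of [v] below some [x < k * y] would eventually bound [u] by [x / k], up to a
    vanishing term, which contradicts [y]. *)
Lemma limn_esup_scale_le u v (k y C : R) : (0 < k)%R ->
  (forall n, (k * u n - C / n.+1%:R <= v n)%R) ->
  limn_esup (fun n => (u n)%:E) = y%:E ->
  (k * y)%:E <= limn_esup (fun n => (v n)%:E).
Proof.
move=> k0 uv uy; rewrite leNgt; apply/negP => vlt.
have [x vx xlt] : exists2 x : R, limn_esup (fun n => (v n)%:E) < x%:E & (x < k * y)%R.
  move: vlt; case: limn_esup => [r| |] // rlt.
    exists ((r + k * y) / 2)%R; [rewrite lte_fin|]; move: rlt; rewrite lte_fin; lra.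
  by exists (k * y - 1)%R; [exact: ltNyr | lra].
have [n0 n0v] := limn_esup_lt _ _ vx.
have : limn_esup (fun n => (u n)%:E) <= (x / k)%:E.
  apply: (limn_esup_le_vanishing _ _ (C / k) n0) => n /n0v; rewrite lee_fin => vn.
  have {}vn := le_trans (uv n) vn.
  rewrite (_ : x / k + C / k / _ = (x + C / n.+1%:R) / k)%R; last by ring.
  by rewrite ler_pdivlMr // mulrC; rewrite lerBlDr in vn.
by rewrite uy lee_fin ler_pdivlMr // mulrC => ?; lra.
Qed.

End UpperLimits.

Lemma conv_ge (R : realDomainType) (t x u v : R) :
  0 <= t <= 1 -> x <= u -> x <= v -> x <= t * u + (1 - t) * v.
Proof.
move=> /andP[t0 t1] xu xv.
have h1 : 0 <= t * (u - x) by apply: mulr_ge0; lra.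
have h2 : 0 <= (1 - t) * (v - x) by apply: mulr_ge0; lra.
lra.
Qed.

(* [next] is shadowed by the function of MathComp's path.v. *)
Local Notation next := Defs.next.

(** * One-slot transitions and expectations *)

Section Dynamics.
Context {R : realType} (S : relay_system R).
Implicit Types (a : policy S) (c m : config S) (w : draw S).

Local Notation p := (detS S).
Local Notation q := (detR S).
Local Notation K := (txcost S).
Local Notation N := (ecap S).

Definition harvest_prob : R := gamma (inord 1 : 'I_(bmax S).+1).
Local Notation g := harvest_prob.

(** Since [qd] is a truncated subtraction, an arrival raises it by one only under this invariant. *)
Definition well_formed c := (dep c <= arr c)%N.

Definition enqueue c : config S := Config (arr c).+1 (dep c) (energy c).

Definition recharge c : config S :=
  Config (arr c) (dep c) (inord (minn N (energy c + 1))).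

Definition transmit m (dr : bool) : config S :=
  if active m then Config (arr m) (dep m + dr) (inord (energy m - K)) else m.

Definition step_mean a c (F : draw S -> R) : R :=
  \sum_w draw_prob a (state_of c) w * F w.

Definition tx_mean (G : config S -> bool -> R) m : R :=
  q * G m true + (1 - q) * G m false.

Lemma next_mid c w : next c w = transmit (mid c w) w.2.
Proof. by case: w => [[[dd ds] h] dr]. Qed.

Lemma energy_le c : (energy c <= N)%N.
Proof. by rewrite -ltnS. Qed.

Lemma inord_energy (e : nat) : (e <= N)%N ->
  (inord e : 'I_N.+1) = e :> nat.
Proof. by move=> eN; rewrite inordK. Qed.

Lemma gamma_sum (F : nat -> R) : bmax S = 1%N ->
  \sum_(i < (bmax S).+1) gamma i * F i = (1 - g) * F 0%N + g * F 1%N.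
Proof.
(* The size is generalised to a variable so that [subst] can make the index type ['I_2]. *)
have gen n (G : 'I_n.+1 -> R) (H : nat -> R) : n = 1%N ->
    \sum_i G i * H i = G ord0 * H 0%N + G (inord 1) * H 1%N.
  move=> n1; subst n; rewrite big_ord_recl big_ord1.
  have -> : lift ord0 ord0 = inord 1 :> 'I_2 by apply: ord_inj; rewrite inordK.
  by rewrite inordK.
move=> b1; rewrite gen //; congr (_ * _ + _).
have := gen _ (@gamma R S) (fun=> 1) b1.
under eq_bigr do rewrite mulr1.
by rewrite gamma_sum1 !mulr1 => ->; rewrite addrK.
Qed.

Lemma harvest_prob_bounds : bmax S = 1%N -> 0 < g <= 1.
Proof.
move=> b1; have := gamma_mean_gt0 S.
under eq_bigr do rewrite mulrC.
rewrite (gamma_sum (fun n => n%:R)) // mulr0 add0r mulr1 => -> /=.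
rewrite -(gamma_sum1 S) (bigD1 (inord 1)) //= lerDl.
by apply: sumr_ge0 => i _; exact: gamma_ge0.
Qed.

Lemma txcost_gt0 : (0 < K)%N.
Proof. exact: leq_trans (bmax_ge1 S) (bmax_le_txcost S). Qed.

Lemma txcost_lt : (K < N)%N.
Proof. by have := ecap_ge S; have := txcost_gt0; lia. Qed.

Lemma sum_draw (F : draw S -> R) :
  \sum_w F w = \sum_dd \sum_ds \sum_h \sum_dr F (dd, ds, h, dr).
Proof.
rewrite pair_bigA /= pair_bigA /= pair_bigA /=.
by apply: eq_bigr => -[[[dd ds] h] dr].
Qed.

Lemma recharge0 c :
  Config (arr c) (dep c) (inord (minn N (energy c + 0))) = c.
Proof.
case: c => A D e /=; congr Config; apply: val_inj => /=.
by rewrite addn0 inordK; have := ltn_ord e; lia.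
Qed.

(** With [bmax S = 1] the harvest is a Bernoulli variable; the relay's detection is independent of
    the first subslot and is averaged first. *)
Lemma step_meanE a c G : bmax S = 1%N ->
  step_mean a c (fun w => G (mid c w) w.2) =
  a (state_of c) * (p * tx_mean G c + (1 - p) * tx_mean G (enqueue c)) +
  (1 - a (state_of c)) *
     (g * tx_mean G (recharge c) + (1 - g) * tx_mean G c).
Proof.
move=> b1; rewrite /step_mean sum_draw.
set al := a _.
have inner dd ds : \sum_h \sum_dr draw_prob a (state_of c) (dd, ds, h, dr) *
      G (mid c (dd, ds, h, dr)) (dd, ds, h, dr).2 =
    bern al dd * bern p ds * (if dd then tx_mean G (if ds then c else enqueue c)
     else g * tx_mean G (recharge c) + (1 - g) * tx_mean G c).
  (* The last component [true] is a placeholder, which [mid] ignores. *)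
  transitivity (bern al dd * bern p ds *
      \sum_h gamma h * tx_mean G (mid c (dd, ds, h, true))).
    rewrite big_distrr /=; apply: eq_bigr => h _.
    by rewrite big_bool /= /tx_mean -/al; ring.
  congr (_ * _); rewrite /mid; case: dd => /=.
    by rewrite -big_distrl /= gamma_sum1 mul1r.
  rewrite (gamma_sum (fun h => tx_mean G
    (Config (arr c) (dep c) (inord (minn N (energy c + h)))))) //.
  by rewrite recharge0 addrC.
under eq_bigr => dd _ do under eq_bigr => ds _ do rewrite inner.
by rewrite !big_bool /= /bern; ring.
Qed.

Lemma eq_step_mean a c F G : (forall w, F w = G w) ->
  step_mean a c F = step_mean a c G.
Proof. by move=> FG; apply: eq_bigr => w _; rewrite FG. Qed.

Lemma draw_prob_ge0 a s w : is_policy a -> 0 <= draw_prob a s w.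
Proof.
move=> /(_ s) /andP[a0 a1]; case: w => [[[dd ds] h] dr] /=.
have /andP[p0 p1] := detS_prob S; have /andP[q0 q1] := detR_prob S.
have h0 := gamma_ge0 h.
rewrite !mulr_ge0 // /bern; [case: dd|case: ds|case: dr]; lra.
Qed.

Lemma draw_prob_sum1 a c : \sum_w draw_prob a (state_of c) w = 1.
Proof.
rewrite sum_draw.
under eq_bigr => dd _ do under eq_bigr => ds _ do
  under eq_bigr => h _ do rewrite -big_distrr /= big_bool /= subrKC mulr1.
under eq_bigr => dd _ do under eq_bigr => ds _ do
  rewrite -big_distrr /= gamma_sum1 mulr1.
by rewrite !big_bool /= /bern; ring.
Qed.

Lemma step_mean_cst a c x : step_mean a c (fun=> x) = x.
Proof. by rewrite /step_mean -big_distrl /= draw_prob_sum1 mul1r. Qed.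

Lemma step_mean_le a c F G : is_policy a -> (forall w, F w <= G w) ->
  step_mean a c F <= step_mean a c G.
Proof.
by move=> aP FG; apply: ler_sum => w _; rewrite ler_wpM2l ?draw_prob_ge0.
Qed.

Lemma step_mean_lin a c F G x y :
  step_mean a c (fun w => x * F w + y * G w) =
  x * step_mean a c F + y * step_mean a c G.
Proof.
rewrite /step_mean !big_distrr -big_split /=.
by apply: eq_bigr => w _; ring.
Qed.

Lemma expect0 a r c : expect a r 0 c = step_mean a c (r c).
Proof. by []. Qed.

Lemma expectS a r t c :
  expect a r t.+1 c = step_mean a c (fun w => expect a r t (next c w)).
Proof. by []. Qed.

Lemma expect_lin a r1 r2 x y t c :
  expect a (fun c w => x * r1 c w + y * r2 c w) t c =
  x * expect a r1 t c + y * expect a r2 t c.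
Proof.
elim: t c => [|t IH] c; first by rewrite !expect0 step_mean_lin.
by rewrite !expectS -step_mean_lin; apply: eq_step_mean.
Qed.

Lemma expect_cst a x t c : expect a (fun _ _ => x) t c = x.
Proof.
elim: t c => [|t IH] c; first by rewrite expect0 step_mean_cst.
by rewrite expectS -[RHS](step_mean_cst a c); apply: eq_step_mean.
Qed.

Lemma well_formed_init s : well_formed (init s).
Proof. by []. Qed.

Lemma well_formed_next c w : well_formed c -> well_formed (next c w).
Proof.
rewrite next_mid /well_formed => wf.
have wfm : (dep (mid c w) <= arr (mid c w))%N.
  by case: w => [[[[] []] h] dr] /=; lia.
rewrite /transmit /active; case: ifP => //= /andP[]; rewrite /qd.
by case: w.2 => /=; lia.
Qed.

Lemma expect_le a r1 r2 t c : is_policy a -> well_formed c ->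
  (forall c w, well_formed c -> r1 c w <= r2 c w) ->
  expect a r1 t c <= expect a r2 t c.
Proof.
move=> aP + r12; elim: t c => [|t IH] c wf.
  by rewrite !expect0; apply: step_mean_le => // w; apply: r12.
rewrite !expectS; apply: step_mean_le => // w.
by apply: IH; apply: well_formed_next.
Qed.

Lemma expect_ge0 a r t c : is_policy a -> well_formed c ->
  (forall c w, well_formed c -> 0 <= r c w) -> 0 <= expect a r t c.
Proof.
by move=> aP wf r0; rewrite -(expect_cst a 0 t c); apply: expect_le.
Qed.

(** * Accumulated costs and potentials *)

Definition total a r T c : R := \sum_(t < T) expect a r t c.

Lemma total_lin a r1 r2 x y T c :
  total a (fun c w => x * r1 c w + y * r2 c w) T c =
  x * total a r1 T c + y * total a r2 T c.
Proof.
rewrite /total !big_distrr -big_split /=.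
by apply: eq_bigr => t _; rewrite expect_lin.
Qed.

Lemma total_cst a x T c : total a (fun _ _ => x) T c = T%:R * x.
Proof.
rewrite /total; under eq_bigr do rewrite expect_cst.
by rewrite sumr_const card_ord mulr_natl.
Qed.

Lemma totalS a r T c : total a r T.+1 c =
  step_mean a c (fun w => r c w + total a r T (next c w)).
Proof.
rewrite /total big_ord_recl expect0.
under eq_bigr do rewrite expectS.
rewrite /step_mean exchange_big -big_split /=; apply: eq_bigr => w _.
by rewrite mulrDr big_distrr.
Qed.

(** The drift inequality telescopes and leaves the expected final potential as boundary term.
    Negated potentials give the bounds in the other direction. *)
Lemma potential_le_total a (H : config S -> R) r T c : is_policy a ->
  well_formed c ->
  (forall c, well_formed c ->
     H c <= step_mean a c (fun w => r c w + H (next c w))) ->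
  H c <= total a r T c + expect a (fun c _ => H c) T c.
Proof.
move=> aP + Hr; elim: T c => [|T IH] c wf.
  by rewrite /total big_ord0 add0r expect0 step_mean_cst.
rewrite totalS expectS; apply: (le_trans (Hr _ wf)).
have -> : forall x y, x + y = 1 * x + 1 * y :> R by move=> *; rewrite !mul1r.
rewrite -step_mean_lin; apply: step_mean_le => // w.
by rewrite !mul1r -addrA lerD2l IH //; apply: well_formed_next.
Qed.

Definition queue_cost c w : R := ((qd c)%:R + (qd (mid c w))%:R) / 2%:R.

Definition busy c w : R := (active (mid c w))%:R.

(* Mean of [h] at the end of a slot whose state after the first subslot is
   [(n, e)]. *)
Definition tx_state_mean (h : nat -> nat -> R) (n e : nat) : R :=
  if (0 < n)%N && (K <= e)%N then q * h n.-1 (e - K)%N + (1 - q) * h n (e - K)%N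
  else h n e.

Lemma tx_mean_state (v h : nat -> nat -> R) u m :
  tx_mean (fun m dr => u + v (qd m) (energy m) +
    h (qd (transmit m dr)) (energy (transmit m dr))) m =
  u + v (qd m) (energy m) + tx_state_mean h (qd m) (energy m).
Proof.
rewrite /tx_mean /tx_state_mean /transmit -/(active m).
case: ifP => [act|_]; last by ring.
rewrite /= /qd /= inord_energy; last by have := energy_le m; lia.
have -> : (arr m - (dep m + 1) = (arr m - dep m).-1)%N by lia.
by rewrite addn0; ring.
Qed.

(** Turns a drift condition into an inequality between functions of [(n, e)]; [T] is the mean cost
    to go from the middle of the slot. *)
Lemma step_mean_state a c u (v h : nat -> nat -> R) :
  bmax S = 1%N -> well_formed c ->
  let T n e := v n e + tx_state_mean h n e in
  let n := qd c in let e := energy c : nat in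
  step_mean a c (fun w => u + v (qd (mid c w)) (energy (mid c w)) +
    h (qd (next c w)) (energy (next c w))) =
  u + (a (state_of c) * (p * T n e + (1 - p) * T n.+1 e) +
  (1 - a (state_of c)) * (g * T n (minn N e.+1) + (1 - g) * T n e)).
Proof.
move=> b1 wf /=.
under eq_step_mean do rewrite next_mid.
rewrite (step_meanE a c (fun m dr => u + v (qd m) (energy m) +
    h (qd (transmit m dr)) (energy (transmit m dr))) b1).
rewrite !tx_mean_state /=.
have -> : qd (enqueue c) = (qd c).+1.
  by move: wf; rewrite /well_formed /qd /=; lia.
have -> : qd (recharge c) = qd c by [].
rewrite addn1 inord_energy ?geq_minl //.
by ring.
Qed.

Lemma expect_bounded a r x y t c : is_policy a -> well_formed c ->
  (forall c w, well_formed c -> x <= r c w <= y) -> x <= expect a r t c <= y.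
Proof.
move=> aP wf rb; apply/andP; split.
  by rewrite -(expect_cst a x t c); apply: expect_le => // c' w /(rb c' w) /andP[].
by rewrite -(expect_cst a y t c); apply: expect_le => // c' w /(rb c' w) /andP[].
Qed.

(* Slots needed per transmission when every harvested unit is spent on a
   transmission and every decoded packet is delivered. *)
Definition tx_period : R := K%:R / g + q / (1 - p).

(** * Transmission rate: general upper bound, attained by [alphaD] *)

Section Potentials.
Context (b1 : bmax S = 1%N).

Let g_bounds : 0 < g <= 1 := harvest_prob_bounds b1.
Let p_bounds : 0 < p < 1 := detS_prob S.
Let q_bounds : 0 < q < 1 := detR_prob S.

Lemma tx_period_gt0 : 0 < tx_period.
Proof.
have /andP[g0 g1] := g_bounds; have /andP[p0 p1] := p_bounds.
have /andP[q0 q1] := q_bounds.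
by rewrite addr_gt0 ?divr_gt0 ?subr_gt0 ?ltr0n ?txcost_gt0.
Qed.

(** A stored unit is valued at [1 / g] and a packet at [1 / (1 - p)], the mean numbers of slots to
    acquire them by harvesting and by decoding. A transmission spends [K] units and [q] packets on
    average, worth [tx_period]. *)
Lemma tx_state_balance n e :
  tx_period * ((0 < n)%N && (K <= e)%N)%:R +
  tx_state_mean (fun n e => e%:R / g + n%:R / (1 - p)) n e =
  e%:R / g + n%:R / (1 - p).
Proof.
have /andP[g0 g1] := g_bounds; have /andP[p0 p1] := p_bounds.
rewrite /tx_state_mean; case: ifP => [/andP[n0 Ke]|_]; last first.
  by rewrite mulr0 add0r.
rewrite natrB // -subn1 natrB // /tx_period mulr1.
field; rewrite !gt_eqF ?subr_gt0 //.
Qed.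

Lemma tx_state_meanN h n e :
  tx_state_mean (fun n e => - h n e) n e = - tx_state_mean h n e.
Proof. by rewrite /tx_state_mean; case: ifP => _ //; ring. Qed.

Lemma state_potential a (u : nat -> R) (v h : nat -> nat -> R) r T c : is_policy a -> well_formed c ->
  (forall c w, r c w = u (qd c) + v (qd (mid c w)) (energy (mid c w))) ->
  (let M n e := v n e + tx_state_mean h n e in
   forall s : state S, h s.1 s.2 <=
     u s.1 + (a s * (p * M s.1 s.2 + (1 - p) * M s.1.+1 s.2) +
       (1 - a s) * (g * M s.1 (minn N s.2.+1) + (1 - g) * M s.1 s.2))) ->
  h (qd c) (energy c) <=
  total a r T c + expect a (fun c _ => h (qd c) (energy c)) T c.
Proof.
move=> aP wf rE hM.
apply: (potential_le_total a (fun c => h (qd c) (energy c))) => //.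
move=> {wf}c wf.
rewrite (eq_step_mean a c _ (fun w => u (qd c) + v (qd (mid c w))
  (energy (mid c w)) + h (qd (next c w)) (energy (next c w)))); last first.
  by move=> w; rewrite rE.
by rewrite step_mean_state //; exact: (hM (state_of c)).
Qed.

(** The drift is affine in [a s], so an arbitrary policy is covered by checking pure decoding and
    pure harvesting. *)
Lemma conv_shift_ge a s (x u y z : R) : is_policy a ->
  x <= u + y -> x <= u + z -> x <= u + (a s * y + (1 - a s) * z).
Proof.
move=> aP xy xz; rewrite (_ : u + _ = a s * (u + y) + (1 - a s) * (u + z)).
  by apply: conv_ge.
by ring.
Qed.

Lemma harvest_le e : (e <= N)%N ->
  (minn N e.+1)%:R / g <= e%:R / g + g^-1.
Proof.
move=> eN; have /andP[g0 _] := g_bounds.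
rewrite -[X in _ + X]mul1r -mulrDl ler_pM2r ?invr_gt0 // natr1 ler_nat.
exact: geq_minr.
Qed.

(** Before transmission, the potential of [tx_state_balance] gains exactly 1 in the mean by
    decoding, and at most 1 by harvesting because units may be blocked. *)
Lemma busy_upper a c T : is_policy a -> well_formed c ->
  tx_period * total a busy T c <=
  T%:R + ((energy c)%:R / g + (qd c)%:R / (1 - p)).
Proof.
move=> aP wf; have /andP[g0 g1] := g_bounds; have /andP[p0 p1] := p_bounds.
pose z n e : R := e%:R / g + n%:R / (1 - p); pose h n e := - z n e.
have z_ge0 n e : 0 <= z n e.
  by rewrite addr_ge0 ?divr_ge0 ?subr_ge0 ?ler0n // ltW.
have ET : expect a (fun c _ => h (qd c) (energy c)) T c <= 0.
  by rewrite -(expect_cst a 0 T c); apply: expect_le => // *; rewrite oppr_le0.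
suff : h (qd c) (energy c) <= 1 * (T%:R * 1) + - tx_period * total a busy T c
    + expect a (fun c _ => h (qd c) (energy c)) T c.
  by rewrite /h /z; lra.
rewrite -(total_cst a 1 T c) -(total_lin a (fun _ _ => 1)).
pose v n e : R := - tx_period * ((0 < n)%N && (K <= e)%N)%:R.
apply: (state_potential a (fun=> 1) v h) => //.
  by move=> c' w; rewrite mulr1.
move=> M [n e] /=; have eN : (e <= N)%N by rewrite -ltnS.
have ME n' e' : M n' e' = - z n' e'.
  by rewrite /M tx_state_meanN /v /z; have := tx_state_balance n' e'; lra.
rewrite !ME /h; apply: conv_shift_ge => //.
  rewrite /z -[n.+1%:R]natr1 le_eqVlt; apply/orP; left; apply/eqP; field.
  by rewrite !gt_eqF ?subr_gt0.
have : g * z n (minn N e.+1) <= g * (z n e + g^-1).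
  by rewrite ler_pM2l // /z; have := harvest_le _ eN; lra.
have : g * g^-1 = 1 by rewrite mulfV ?gt_eqF.
by lra.
Qed.

Lemma txcost_le_pred : (K <= N.-1)%N.
Proof. by have := txcost_lt; lia. Qed.

Lemma alphaD_policy : is_policy (alphaD S).
Proof. by move=> s; rewrite /alphaD; case: ifP; rewrite ?ler01 ?lexx. Qed.

Lemma alphaD_cond (s : state S) (x y : R) (P : R -> Prop) :
  (s.1 = 0%N -> s.2 = N :> nat -> P x) ->
  ((0 < s.1)%N || (s.2 < N)%N -> P y) ->
  P (alphaD S s * x + (1 - alphaD S s) * y).
Proof.
move=> Px Py; rewrite /alphaD; case: ifP => [/andP[/eqP s1 /eqP s2]|].
  by rewrite mul1r subrr mul0r addr0; apply: Px.
move=> ne; rewrite mul0r add0r subr0 mul1r; apply: Py.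
by move: ne; have := ltn_ord s.2; rewrite ltnS; lia.
Qed.

Lemma ecap_pred : N.-1%:R = N%:R - 1 :> R.
Proof.
have N0 : (0 < N)%N by exact: leq_ltn_trans txcost_lt.
by rewrite -[in RHS](prednK N0) -natr1 addrK.
Qed.

(** With an empty queue [alphaD] blocks no unit, since it decodes when the buffer is full. The
    potential must be bounded, as its final value enters with the unfavourable sign. *)
Lemma busy_lower : exists C : R, forall c T, well_formed c ->
  T%:R - C <= tx_period * total (alphaD S) busy T c.
Proof.
have /andP[g0 g1] := g_bounds; have /andP[p0 p1] := p_bounds.
have /andP[q0 q1] := q_bounds.
have ig1 : 1 <= g^-1 by rewrite invr_ge1 // unitfE gt_eqF.
have ip0 : 0 < (1 - p)^-1 by rewrite invr_gt0; lra.
(* Packets beyond the first are ignored, which bounds [y]; the cap [N.-1] writes off in advance the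
   unit blocked when a slot starts with a packet and a full buffer. *)
pose y n e : R := (if n is 0 then e else minn e N.-1)%:R / g +
  (0 < n)%N%:R / (1 - p).
have y_ge0 n e : 0 <= y n e.
  by rewrite addr_ge0 ?divr_ge0 ?subr_ge0 ?ler0n // ltW.
have y_le n e : (e <= N)%N -> y n e <= N%:R / g + (1 - p)^-1.
  move=> eN; apply: lerD.
    by rewrite ler_pM2r ?invr_gt0 // ler_nat; case: n => [|n]; lia.
  by rewrite -[leRHS]mul1r ler_pM2r // lern1 leq_b1.
exists (N%:R / g + (1 - p)^-1) => c T wf; have aP := alphaD_policy.
have ET : expect (alphaD S) (fun c _ => y (qd c) (energy c)) T c
    <= N%:R / g + (1 - p)^-1.
  rewrite -(expect_cst (alphaD S) (N%:R / g + (1 - p)^-1) T c).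
  by apply: expect_le => // c' *; rewrite y_le // energy_le.
suff : y (qd c) (energy c) <= -1 * (T%:R * 1) +
    tx_period * total (alphaD S) busy T c
    + expect (alphaD S) (fun c _ => y (qd c) (energy c)) T c.
  by have := y_ge0 (qd c) (energy c); lra.
rewrite -(total_cst (alphaD S) 1 T c) -(total_lin _ (fun _ _ => 1)).
pose v n e : R := tx_period * ((0 < n)%N && (K <= e)%N)%:R.
apply: (state_potential _ (fun=> -1) v y) => //.
  by move=> c' w; rewrite mulr1.
move=> M [n e] /=; have eN : (e <= N)%N by rewrite -ltnS.
have M0 e' : M 0%N e' = y 0%N e' by rewrite /M /v mulr0 add0r.
(* In the middle of a slot the energy counts in full: either it is below [K <= N.-1], or the
   transmission brings it down to at most [N - K]. *)
have MS n' e' : (e' <= N)%N -> e'%:R / g + (1 - p)^-1 <= M n'.+1 e'.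
  move=> e'N; rewrite /M /v /tx_state_mean /y /=; case: ifP => Ke; last first.
    rewrite mulr0 add0r mul1r (minn_idPl _) //.
    by apply: leq_trans txcost_le_pred; rewrite ltnW // ltnNge Ke.
  have -> : minn (e' - K) N.-1 = (e' - K)%N.
    by clear -e'N; have := txcost_gt0; lia.
  rewrite mulr1 natrB // /tx_period.
  case: n' => [|n'].
    rewrite !natrB // !mulr0n !mulr1n le_eqVlt; apply/orP; left; apply/eqP; field.
    by rewrite !gt_eqF ?subr_gt0.
  rewrite !natrB // !mulr1n.
  have : 0 <= q / (1 - p) by rewrite divr_ge0 // ltW //; lra.
  by lra.
apply: (alphaD_cond (n, e) _ _ (fun z => y n e <= -1 + z)) => /= [n0 eN'|].
  rewrite n0 eN' M0; have := MS 0%N N (leqnn _).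
  rewrite {2}/y /= mul0r addr0 => h.
  have : (1 - p) * (N%:R / g + (1 - p)^-1) <= (1 - p) * M 1%N N.
    by rewrite ler_pM2l //; lra.
  by rewrite mulrDr mulfV ?gt_eqF ?subr_gt0 // /y /=; lra.
case: n => [|n] /= ne.
  rewrite !M0 /y /= !mul0r !addr0.
  have -> : minn N e.+1 = e.+1 by apply/minn_idPr.
  rewrite -natr1 le_eqVlt; apply/orP; left; apply/eqP; field.
  by rewrite gt_eqF.
have m1 := MS n _ (geq_minl N e.+1); have m2 := MS n _ eN.
have {}m1 : g * ((minn N e.+1)%:R / g + (1 - p)^-1) <= g * M n.+1 (minn N e.+1).
  by rewrite ler_pM2l.
have {}m2 : (1 - g) * (e%:R / g + (1 - p)^-1) <= (1 - g) * M n.+1 e.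
  by rewrite ler_wpM2l //; lra.
rewrite /y /= mul1r.
move: m1; rewrite mulrDr mulrCA mulfV ?gt_eqF // mulr1 => m1.
have [eN' | eN'] := ltnP e N.
  have E : minn e N.-1 = e by clear -eN'; lia.
  have E' : minn N e.+1 = e.+1 by apply/minn_idPr.
  rewrite E E' in m1 *; rewrite -natr1 in m1.
  have : g * (e%:R / g) = e%:R by field; rewrite gt_eqF.
  by lra.
have E : minn e N.-1 = N.-1 by clear -eN'; lia.
have E' : minn N e.+1 = N by clear -eN'; lia.
have E'' : nat_of_ord e = N by clear -eN eN'; lia.
rewrite E E' E'' in m1 m2 *; rewrite ecap_pred mulrBl.
have : g * (N%:R / g) = N%:R by field; rewrite gt_eqF.
have : 1 / g = g^-1 by rewrite mul1r.
by lra.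
Qed.

(** * Lower bound on the mean queue length *)

Context (phi : nat -> R)
  (phi_low : forall e, (e < K)%N -> phi e = 1 + (g * phi e.+1 + (1 - g) * phi e))
  (phi_high : forall e, (K <= e <= N)%N -> phi e =
     (1 - q) * (1 + (g * phi (e - K).+1 + (1 - g) * phi (e - K)%N)))
  (phi_step : forall e, (e < N)%N -> phi e.+1 <= phi e)
  (phi_ge0 : forall e, (e <= N)%N -> 0 <= phi e).

(* Mean remaining delay, counted from the beginning of a slot, of a packet that
   is alone at the relay and finds [e] units of energy. *)
Definition lone_delay (e : nat) : R :=
  1 + (g * phi (minn N e.+1) + (1 - g) * phi e).

(* The same for a packet entering an empty relay with a full energy buffer,
   counted from its entry in the middle of a slot. *)
Definition best_delay : R := phi N + 2^-1.

Lemma phi_mono i j : (i <= j)%N -> (j <= N)%N -> phi j <= phi i.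
Proof.
elim: j => [|j IH]; first by rewrite leqn0 => /eqP ->.
rewrite leq_eqVlt => /orP[/eqP -> //|ij] jN.
exact: le_trans (phi_step _ jN) (IH ij (ltnW jN)).
Qed.

Lemma phi_lowE e : (e < K)%N -> phi e = lone_delay e.
Proof.
move=> eK; rewrite /lone_delay (minn_idPr _) -?phi_low //.
exact: leq_trans eK (ltnW txcost_lt).
Qed.

Lemma phi_highE e : (K <= e <= N)%N -> phi e = (1 - q) * lone_delay (e - K).
Proof.
move=> eK; rewrite phi_high // /lone_delay (minn_idPr _) //.
by clear -eK; have := txcost_gt0; lia.
Qed.

Lemma conv_le (t x u v : R) : 0 <= t <= 1 -> u <= x -> v <= x ->
  t * u + (1 - t) * v <= x.
Proof.
by move=> t01 ux vx; rewrite -lerN2 opprD -!mulrN conv_ge ?lerN2.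
Qed.

Lemma harvest_prob01 : 0 <= g <= 1.
Proof. by have /andP[/ltW -> ->] := g_bounds. Qed.

Lemma lone_delay_ge e : (e <= N)%N -> best_delay + 2^-1 <= lone_delay e.
Proof.
move=> eN.
have : phi N <= g * phi (minn N e.+1) + (1 - g) * phi e.
  by apply: conv_ge; rewrite ?harvest_prob01 ?phi_mono ?geq_minl.
by rewrite /best_delay /lone_delay; lra.
Qed.

Lemma lone_delay_le e : (e <= N)%N -> lone_delay e <= 1 + phi e.
Proof.
move=> eN; rewrite lerD2l; apply: conv_le; rewrite ?harvest_prob01 //.
by apply: phi_mono; rewrite ?geq_minl // leq_min eN leqnSn.
Qed.

Lemma best_delay_gt0 : 0 < best_delay.
Proof. by rewrite /best_delay; have := phi_ge0 N (leqnn _); lra. Qed.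

(* Only the head-of-line packet is counted: when it leaves, the next one takes
   over with a remaining delay of at least [best_delay]. *)
Definition head_cost (n e : nat) : R :=
  if n is 0 then 0 else lone_delay e - best_delay.

(** Cost of the second subslot: half a slot per packet, with [best_delay] refunded for each expected
    delivery. *)
Definition net_cost (n e : nat) : R :=
  n%:R / 2 - best_delay * q * ((0 < n)%N && (K <= e)%N)%:R.

Lemma head_cost_ge0 n e : (e <= N)%N -> 0 <= head_cost n e.
Proof.
by case: n => [|n] eN //=; have := lone_delay_ge _ eN; lra.
Qed.

Lemma head_cost_le n e : (e <= N)%N -> head_cost n e <= 1 + phi 0%N.
Proof.
case: n => [|n] eN /=; first by rewrite addr_ge0 ?phi_ge0.
have := lone_delay_le _ eN; have := phi_mono 0%N e (leq0n _) eN.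
by have := best_delay_gt0; lra.
Qed.

Lemma mid_cost0 e : net_cost 0 e + tx_state_mean head_cost 0 e = 0.
Proof. by rewrite /net_cost /tx_state_mean /= mul0r mulr0 subrr addr0. Qed.

(** The equations of [phi] enter here: a lone packet in mid-slot still has [phi e + 1/2] to wait. *)
Lemma mid_cost1 e : (e <= N)%N ->
  net_cost 1 e + tx_state_mean head_cost 1 e = 2^-1 + phi e - best_delay.
Proof.
move=> eN; rewrite /net_cost /tx_state_mean /=; case: (leqP K e) => Ke.
  by rewrite mulr1 phi_highE ?Ke ?eN //; lra.
by rewrite mulr0 (phi_lowE _ Ke); lra.
Qed.

(** When a delivered packet leaves others behind, the next one takes over with a [lone_delay] above
    [best_delay], which covers the refund. *)
Lemma mid_cost_ge n e : (e <= N)%N ->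
  n.+1%:R / 2 + phi e - best_delay <=
  net_cost n.+1 e + tx_state_mean head_cost n.+1 e.
Proof.
move=> eN; case: n => [|n]; first by rewrite mid_cost1 // mul1r.
rewrite /net_cost /tx_state_mean /=; case: (leqP K e) => Ke; last first.
  by rewrite mulr0 (phi_lowE _ Ke); lra.
rewrite mulr1 phi_highE ?Ke ?eN //.
have eKN : (e - K <= N)%N by exact: leq_trans (leq_subr _ _) eN.
have /andP[q0 q1] := q_bounds.
have : q * (best_delay + 2^-1) <= q * lone_delay (e - K).
  by rewrite ler_pM2l // lone_delay_ge.
by lra.
Qed.

(** Harvesting follows the recursion of [phi], decoding forgoes a harvest, and a packet entering an
    empty relay has at least [best_delay] to wait because [phi] is least at [N]. *)
Lemma queue_lower a c T : is_policy a -> well_formed c ->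
  best_delay * q * total a busy T c - (1 + phi 0%N) <= total a queue_cost T c.
Proof.
move=> aP wf; have /andP[p0 p1] := p_bounds.
have ET : expect a (fun c _ => head_cost (qd c) (energy c)) T c <= 1 + phi 0%N.
  rewrite -(expect_cst a (1 + phi 0%N) T c).
  by apply: expect_le => // c' *; rewrite head_cost_le // energy_le.
have W0 := head_cost_ge0 (qd c) _ (energy_le c).
suff : head_cost (qd c) (energy c) <= 1 * total a queue_cost T c +
    - (best_delay * q) * total a busy T c
    + expect a (fun c _ => head_cost (qd c) (energy c)) T c by lra.
rewrite -total_lin.
apply: (state_potential a (fun n => n%:R / 2) net_cost head_cost) => //.
  by move=> c' w; rewrite /queue_cost /net_cost /busy /active; lra.
move=> M [n e] /=; have eN : (e <= N)%N by rewrite -ltnS.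
have m1 e' : (e' <= N)%N -> 0 <= M 1%N e'.
  move=> e'N; rewrite /M mid_cost1 // /best_delay.
  by have := phi_mono e' N e'N (leqnn _); lra.
have M0 e' : M 0%N e' = 0 by exact: mid_cost0.
case: n => [|n]; apply: conv_shift_ge => //=.
- by rewrite mul0r add0r M0 mulr0 add0r mulr_ge0 ?m1 //; lra.
- by rewrite mul0r add0r !M0 !mulr0 addr0.
- have h1 := mid_cost_ge n e eN; have h2 := mid_cost_ge n.+1 e eN.
  have : n.+1%:R / 2 + phi e - best_delay <= (1 - p) * M n.+2 e + (1 - (1 - p)) * M n.+1 e.
    apply: conv_ge => //; first by lra.
    by apply: le_trans h2; rewrite -[n.+2%:R]natr1; lra.
  have := lone_delay_le _ eN; rewrite -[n.+1%:R]natr1.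
  have : 0 <= n%:R :> R by [].
  by lra.
- have h1 := mid_cost_ge n e eN; have h2 := mid_cost_ge n _ (geq_minl N e.+1).
  have : g * (n.+1%:R / 2 + phi (minn N e.+1) - best_delay)
      <= g * M n.+1 (minn N e.+1).
    by have /andP[g0 _] := g_bounds; rewrite ler_pM2l.
  have : (1 - g) * (n.+1%:R / 2 + phi e - best_delay) <= (1 - g) * M n.+1 e.
    by have /andP[_ g1] := g_bounds; rewrite ler_wpM2l // subr_ge0.
  rewrite /lone_delay -[n.+1%:R]natr1.
  have : 0 <= n%:R :> R by [].
  by lra.
Qed.

(** * Upper bound on the queue length under [alphaD] *)

(* Dominates the mean time to empty the relay when every slot is spent
   harvesting; the cap [N.-1] accounts for the unit lost when a slot starts with
   a full energy buffer. *)
Definition drain_time (n e : nat) : R :=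
  (n%:R * K%:R / q - (minn e N.-1)%:R + N%:R) / g.

Lemma drain_time_ge0 n e : 0 <= drain_time n e.
Proof.
have /andP[g0 _] := g_bounds; have /andP[q0 _] := q_bounds.
apply: divr_ge0 (ltW g0).
have : (minn e N.-1)%:R <= N%:R :> R.
  by rewrite ler_nat; apply: leq_trans (geq_minr _ _) (leq_pred _).
have : 0 <= n%:R * K%:R / q by rewrite !mulr_ge0 ?invr_ge0 // ltW.
by lra.
Qed.

Lemma drain_time_low n e : (e <= N.-1)%N ->
  drain_time n e = (n%:R * K%:R / q - e%:R + N%:R) / g.
Proof. by move=> /minn_idPl eN; rewrite /drain_time eN. Qed.

(** A transmission preserves the mean: the [K] units spent offset a success of probability [q] worth
    [K / q]. It leaves at most [N - K] units, so the cap is not felt. *)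
Lemma mid_drain n e : (0 < n)%N -> (e <= N)%N ->
  tx_state_mean drain_time n e = (n%:R * K%:R / q - e%:R + N%:R) / g.
Proof.
move=> n0 eN; rewrite /tx_state_mean n0 /=.
have /andP[g0 _] := g_bounds; have /andP[q0 _] := q_bounds.
case: (leqP K e) => Ke; last first.
  by rewrite drain_time_low //; apply: leq_trans (ltnW Ke) txcost_le_pred.
have eKN : (e - K <= N.-1)%N by clear -eN; have := txcost_gt0; lia.
rewrite !drain_time_low // natrB // -subn1 natrB //.
by field; rewrite !gt_eqF.
Qed.

(** At a full buffer no unit is gained, but the one withheld by the cap is recovered, and
    [1 / g >= 1]. *)
Lemma drain_time_step n e : (0 < n)%N -> (e <= N)%N ->
  g * tx_state_mean drain_time n (minn N e.+1) +
  (1 - g) * tx_state_mean drain_time n e <= drain_time n e - 1.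
Proof.
move=> n0 eN; have /andP[g0 g1] := g_bounds; have /andP[q0 _] := q_bounds.
rewrite !mid_drain ?geq_minl //.
move: eN; rewrite leq_eqVlt => /orP[/eqP -> | eN].
  rewrite (minn_idPl (leqnSn _)) /drain_time (minn_idPr (leq_pred _)) ecap_pred.
  have : 1 <= g^-1 by rewrite invr_ge1 // unitfE gt_eqF.
  by lra.
rewrite (minn_idPr eN) -natr1 drain_time_low; last by clear -eN; lia.
by rewrite le_eqVlt; apply/orP; left; apply/eqP; field; rewrite !gt_eqF.
Qed.

(** Under [alphaD] several packets are present only while an initial backlog drains. The second term
    pays for these slots at a rate covering the queue length and the bound on [head_cost]. *)
Definition drained_cost (n e : nat) : R :=
  head_cost n e +
  if (1 < n)%N then (n%:R + (1 + phi 0%N)) * drain_time n e else 0.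

Lemma drained_cost_ge0 n e : (e <= N)%N -> 0 <= drained_cost n e.
Proof.
move=> eN; rewrite addr_ge0 ?head_cost_ge0 //; case: ifP => // _.
by rewrite mulr_ge0 ?drain_time_ge0 // !addr_ge0 ?phi_ge0.
Qed.

Lemma drained_cost_le k n e : (e <= N)%N -> (n <= k)%N ->
  drained_cost n e <=
  1 + phi 0%N + (k%:R + (1 + phi 0%N)) * drain_time n e.
Proof.
move=> eN nk; apply: lerD; first exact: head_cost_le.
have phi0 := phi_ge0 0 (leq0n _); case: ifP => _; last first.
  by rewrite mulr_ge0 ?drain_time_ge0 // !addr_ge0.
by rewrite ler_wpM2r ?drain_time_ge0 // lerD2r ler_nat.
Qed.

Lemma mid_drained_small n e : (n <= 1)%N ->
  tx_state_mean drained_cost n e = tx_state_mean head_cost n e.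
Proof.
by case: n => [|[|]] // _; rewrite /tx_state_mean /drained_cost /= !addr0.
Qed.

Lemma mid_drained_le n e : (0 < n)%N -> (e <= N)%N ->
  net_cost n e + tx_state_mean drained_cost n e <=
  n%:R / 2 + (1 + phi 0%N) +
  (n%:R + (1 + phi 0%N)) * tx_state_mean drain_time n e.
Proof.
move=> n0 eN; have /andP[q0 q1] := q_bounds.
have eKN : (e - K <= N)%N by exact: leq_trans (leq_subr _ _) eN.
have cost : net_cost n e <= n%:R / 2.
  by rewrite lerBlDl lerDr !mulr_ge0 // ltW ?best_delay_gt0.
rewrite /tx_state_mean n0 /=; case: ifP => _; last first.
  by have := drained_cost_le n n e eN (leqnn _); lra.
have := drained_cost_le n n.-1 _ eKN (leq_pred _).
rewrite -(ler_pM2l q0) => h1.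
have := drained_cost_le n n _ eKN (leqnn _).
rewrite -(ler_pM2l (_ : 0 < 1 - q)) ?subr_gt0 // => h2.
by lra.
Qed.

(** With at most one packet the drift is balanced exactly; only the backlog leaves slack. The bound
    thus matches [queue_lower] up to boundary terms. *)
Lemma queue_upper T c : well_formed c ->
  total (alphaD S) queue_cost T c <=
  best_delay * q * total (alphaD S) busy T c + drained_cost (qd c) (energy c).
Proof.
move=> wf; have aP := alphaD_policy.
have /andP[p0 p1] := p_bounds; have /andP[g0 g1] := g_bounds.
pose h n e := - drained_cost n e.
have ET : expect (alphaD S) (fun c _ => h (qd c) (energy c)) T c <= 0.
  rewrite -(expect_cst (alphaD S) 0 T c); apply: expect_le => // c' *.
  by rewrite oppr_le0 drained_cost_ge0 // energy_le.
suff : h (qd c) (energy c) <= best_delay * q * total (alphaD S) busy T c +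
    -1 * total (alphaD S) queue_cost T c
    + expect (alphaD S) (fun c _ => h (qd c) (energy c)) T c.
  by rewrite /h; lra.
rewrite -total_lin.
apply: (state_potential _ (fun n => - (n%:R / 2)) (fun n e => - net_cost n e) h).
- exact: aP.
- exact: wf.
- by move=> c' w; rewrite /queue_cost /net_cost /busy /active; lra.
move=> M [n e] /=; have eN : (e <= N)%N by rewrite -ltnS.
have ME n' e' :
    M n' e' = - (net_cost n' e' + tx_state_mean drained_cost n' e').
  by rewrite /M tx_state_meanN; lra.
have M0 e' : M 0%N e' = 0.
  by rewrite ME mid_drained_small // mid_cost0 oppr0.
have M1 e' : (e' <= N)%N -> M 1%N e' = best_delay - 2^-1 - phi e'.
  by move=> e'N; rewrite ME mid_drained_small // mid_cost1 //; lra.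
apply: (alphaD_cond (n, e) _ _ (fun z => h n e <= - (n%:R / 2) + z)) => /= [n0 eN'|].
  rewrite n0 eN' M0 M1 // /h /drained_cost /= /best_delay.
  by rewrite addrK subrr !mulr0 mul0r !addr0 oppr0.
case: n => [|[|n]] ne.
- by rewrite !M0 /h /drained_cost /= !mulr0 mul0r !addr0.
- rewrite !M1 ?geq_minl // /h /drained_cost /= /lone_delay addr0.
  by lra.
set k := n.+2; have k0 : (0 < k)%N by [].
have h1 := mid_drained_le k _ k0 (geq_minl N e.+1).
have h2 := mid_drained_le k _ k0 eN.
have h3 := drain_time_step k _ k0 eN.
rewrite !ME /h {1}/drained_cost (_ : (1 < k)%N = true) //.
have h4 := head_cost_ge0 k _ eN; have phi0 := phi_ge0 0 (leq0n _).
rewrite -(ler_pM2l g0) in h1.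
have {}h2 := ler_wpM2l (_ : 0 <= 1 - g) h2; rewrite subr_ge0 g1 in h2.
have {}h2 := h2 isT.
have {}h3 := ler_wpM2l (_ : 0 <= k%:R + (1 + phi 0%N)) h3.
have {}h3 := h3 (addr_ge0 (ler0n _ _) (addr_ge0 ler01 phi0)).
by lra.
Qed.

(** * Delay of an individual packet *)

Definition presence i c w : R :=
  ((in_buffer i c)%:R + (in_buffer i (mid c w))%:R) / 2%:R.

(** The packet is treated as if alone, since packets ahead can only delay it; [best_delay] is
    deducted for good once it has entered. *)
Definition packet_cost i c : R :=
  (if in_buffer i c then lone_delay (energy c) else 0) -
  best_delay * (i < arr c)%N%:R.

Definition packet_mid_cost i c : R :=
  if in_buffer i c then 2^-1 + phi (energy c) - best_delay
  else - (best_delay * (i < arr c)%N%:R).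

Lemma packet_mid_cost_le i x m : well_formed m ->
  x / 2 + packet_mid_cost i m <=
  tx_mean (fun m dr => (x + (in_buffer i m)%:R) / 2 +
    packet_cost i (transmit m dr)) m.
Proof.
rewrite /well_formed => wf; have /andP[q0 q1] := q_bounds.
have eN := energy_le m.
rewrite /packet_mid_cost; case: ifP => [inb|ninb]; last first.
  have out dr : in_buffer i (transmit m dr) = false.
    apply: contraFF ninb; rewrite /transmit; case: ifP => // _ /andP[/= di ia].
    by rewrite /in_buffer ia andbT; exact: leq_trans (leq_addr _ _) di.
  have arrE dr : arr (transmit m dr) = arr m by rewrite /transmit; case: ifP.
  by rewrite /tx_mean /packet_cost !out !arrE ninb /=; lra.
have arrE dr : arr (transmit m dr) = arr m by rewrite /transmit; case: ifP.
have iarr : (i < arr m)%N by case/andP: inb.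
rewrite /tx_mean /packet_cost !arrE iarr inb.
case: (boolP (active m)) => act.
  have Ke : (K <= energy m)%N by case/andP: act.
  have eKN : (energy m - K <= N)%N by exact: leq_trans (leq_subr _ _) eN.
  have tE dr : nat_of_ord (energy (transmit m dr)) = (energy m - K)%N.
    by rewrite /transmit act /= inord_energy.
  have in0 : in_buffer i (transmit m false).
    by move: inb; rewrite /transmit act /in_buffer /= addn0.
  rewrite in0 !tE phi_highE ?Ke ?eN //.
  have : 0 <= q * lone_delay (energy m - K).
    rewrite mulr_ge0 ?(ltW q0) //.
    by have := lone_delay_ge _ eKN; have := best_delay_gt0; lra.
  by case: ifP => _ /=; lra.
have eK : (energy m < K)%N.
  move: act inb; rewrite /active /in_buffer /qd; clear -wf.
  by case: (leqP K (energy m)) => //; lia.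
have tE dr : transmit m dr = m by rewrite /transmit (negbTE act).
by rewrite !tE inb (phi_lowE _ eK) /=; lra.
Qed.

Lemma packet_cost_step i a c : is_policy a -> well_formed c ->
  packet_cost i c <=
  step_mean a c (fun w => presence i c w + packet_cost i (next c w)).
Proof.
move=> aP wf; have /andP[p0 p1] := p_bounds; have eN := energy_le c.
under eq_step_mean do rewrite next_mid.
rewrite (step_meanE a c (fun m dr =>
  ((in_buffer i c)%:R + (in_buffer i m)%:R) / 2 +
    packet_cost i (transmit m dr)) b1).
have mono m : well_formed m -> _ := packet_mid_cost_le i (in_buffer i c)%:R m.
have wfq : well_formed (enqueue c).
  by move: wf; rewrite /well_formed /=; clear; lia.
have wfr : well_formed (recharge c) by [].
have hq : phi N <= phi (energy c) by apply: phi_mono.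
have hc := mono _ wf; have he := mono _ wfq; have hr := mono _ wfr.
have h01 := harvest_prob01.
apply: conv_ge; first exact: aP.
  apply: le_trans (_ : (in_buffer i c)%:R / 2 + (p * packet_mid_cost i c +
     (1 - p) * packet_mid_cost i (enqueue c)) <= _); last first.
    have := ler_wpM2l (ltW p0) hc.
    have := ler_wpM2l (_ : 0 <= 1 - p) he; rewrite subr_ge0 (ltW p1).
    by move=> /(_ isT); lra.
  rewrite -lerBlDl; apply: conv_ge; first by rewrite ltW //= ltW.
    rewrite /packet_cost /packet_mid_cost; case: ifP => inb.
      rewrite (_ : (i < arr c)%N); last by case/andP: inb.
      by have := lone_delay_le _ eN; rewrite /=; lra.
    by rewrite /=; lra.
  rewrite /packet_cost /packet_mid_cost; case: ifP => inb.
    have [d1 d2] : in_buffer i (enqueue c) /\ (i < arr c)%N.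
      by move: inb; rewrite /in_buffer /=; clear; lia.
    by rewrite d1 d2; have := lone_delay_le _ eN; rewrite /=; lra.
  (* If the packet enters in this slot, its cost [phi e - phi N] is nonnegative by monotonicity. *)
  case: ifP => inb'.
    have -> : (i < arr c)%N = false.
      by move: inb inb'; rewrite /in_buffer /=; clear; lia.
    by rewrite /best_delay /=; lra.
  have -> : (i < arr (enqueue c))%N = (i < arr c)%N.
    by move: wf inb inb'; rewrite /well_formed /in_buffer /=; clear; lia.
  by rewrite /=; lra.
apply: le_trans (_ : (in_buffer i c)%:R / 2 +
   (g * packet_mid_cost i (recharge c) + (1 - g) * packet_mid_cost i c) <= _);
  last first.
  have /andP[g0 g1] := g_bounds.
  have := ler_wpM2l (ltW g0) hr.
  have := ler_wpM2l (_ : 0 <= 1 - g) hc; rewrite subr_ge0 g1.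
  by move=> /(_ isT); lra.
rewrite /packet_cost /packet_mid_cost.
rewrite (_ : in_buffer i (recharge c) = in_buffer i c) //.
rewrite (_ : arr (recharge c) = arr c) //; case: ifP => inb /=; last by lra.
rewrite (_ : (i < arr c)%N); last by case/andP: inb.
rewrite /lone_delay /= addn1 inord_energy ?geq_minl //.
by lra.
Qed.

(** The positive part of the final potential is at most [1 + phi 0] and vanishes unless the packet
    is still in the buffer, an event dominated by twice [presence]. *)
Lemma presence_lower i a T s : is_policy a ->
  best_delay * expect a (fun c _ => (i < arr c)%N%:R) T (init s) <=
  total a (presence i) T (init s) +
  (1 + phi 0%N) * (2 * expect a (presence i) T (init s)).
Proof.
move=> aP; have wf := well_formed_init s.
have := potential_le_total a (packet_cost i) (presence i) T (init s) aP wf.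
move=> /(_ (fun c => packet_cost_step i a c aP)) pot.
have init_ge0 : 0 <= packet_cost i (init s).
  have eN := energy_le (init s).
  rewrite /packet_cost /in_buffer andTb; case: ifP => _ /=; last first.
    by rewrite mulr0 subr0.
  by rewrite mulr1; have := lone_delay_ge _ eN; rewrite /=; lra.
suff : expect a (fun c _ => packet_cost i c) T (init s) <=
    (1 + phi 0%N) * 2 * expect a (presence i) T (init s) +
    - best_delay * expect a (fun c _ => (i < arr c)%N%:R) T (init s) by lra.
rewrite -expect_lin; apply: expect_le => // c w _.
rewrite /packet_cost /presence; have phi0 := phi_ge0 0 (leq0n _).
have : 0 <= (1 + phi 0%N) * (in_buffer i (mid c w))%:R.
  by rewrite mulr_ge0 ?addr_ge0.
case: ifP => inb; rewrite ?inb /=; last by lra.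
have eN := energy_le c; have := lone_delay_le _ eN.
by have := phi_mono 0%N _ (leq0n _) eN; lra.
Qed.

Lemma expect_nondecreasing a (f : config S -> R) t c : is_policy a ->
  (forall c w, f c <= f (next c w)) ->
  expect a (fun c _ => f c) t c <= expect a (fun c _ => f c) t.+1 c.
Proof.
move=> aP fP; elim: t c => [|t IH] c.
  rewrite expectS expect0; apply: step_mean_le => // w.
  by rewrite expect0 step_mean_cst.
by rewrite expectS [leRHS]expectS; apply: step_mean_le.
Qed.

Lemma arr_next c w : (arr c <= arr (next c w))%N.
Proof.
rewrite next_mid /transmit.
by case: w => [[[[] []] h] dr] /=; case: ifP => _ /=; rewrite ?leqnSn.
Qed.

Lemma expect_arr_le a i t T c : is_policy a -> (t <= T)%N ->
  expect a (fun c _ => (i < arr c)%N%:R) t c <=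
  expect a (fun c _ => (i < arr c)%N%:R) T c.
Proof.
move=> aP /subnKC <-; elim: (T - t)%N => [|k IH]; first by rewrite addn0.
rewrite addnS; apply: (le_trans IH).
apply: (expect_nondecreasing a (fun c => (i < arr c)%N%:R)) => // c' w.
by rewrite ler_nat; case: (ltnP i (arr c')) => // /leq_trans -> //; exact: arr_next.
Qed.

(** Decoding in state [s] succeeds in adding a packet with probability [a s * (1 - p)], and [arr]
    never decreases afterwards. *)
Lemma first_arrival a s t c : is_policy a ->
  a s * (1 - p) * expect a (fun c _ => (state_of c == s)%:R) t c <=
  expect a (fun c _ => (0 < arr c)%N%:R) t.+1 c.
Proof.
move=> aP; have /andP[p0 p1] := p_bounds.
elim: t c => [|t IH] c.
  rewrite expectS !expect0 step_mean_cst.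
  under eq_step_mean do rewrite expect0 step_mean_cst next_mid.
  rewrite (step_meanE a c (fun m dr => (0 < arr (transmit m dr))%N%:R) b1).
  have G0 m : 0 <= tx_mean (fun m dr => (0 < arr (transmit m dr))%N%:R) m.
    by have /andP[q0 q1] := q_bounds; rewrite addr_ge0 ?mulr_ge0 //; lra.
  have -> : tx_mean (fun m dr => (0 < arr (transmit m dr))%N%:R) (enqueue c) = 1.
    by rewrite /tx_mean /transmit; case: ifP => _ /=; ring.
  have /andP[g0 g1] := g_bounds; have /andP[a0 a1] := aP (state_of c).
  have h1 : 0 <= a (state_of c) * (p * tx_mean
      (fun m dr => (0 < arr (transmit m dr))%N%:R) c).
    by rewrite !mulr_ge0 // ltW.
  have h2 : 0 <= (1 - a (state_of c)) * (g * tx_mean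
      (fun m dr => (0 < arr (transmit m dr))%N%:R) (recharge c) +
      (1 - g) * tx_mean (fun m dr => (0 < arr (transmit m dr))%N%:R) c).
    by rewrite mulr_ge0 ?subr_ge0 // addr_ge0 ?mulr_ge0 ?subr_ge0 // ltW.
  have [<-|_] := eqVneq (state_of c) s; first by rewrite mulr1n; lra.
  have : 0 <= a (state_of c) * (1 - p) by rewrite mulr_ge0 ?subr_ge0 // ltW.
  by rewrite mulr0n; lra.
rewrite !expectS -[leLHS]addr0.
rewrite -(mul0r (step_mean a c (fun=> 0))) -step_mean_lin.
apply: step_mean_le => // w; rewrite mul0r addr0.
exact: le_trans (IH _) _.
Qed.

Lemma presence_ge0 i c w : 0 <= presence i c w.
Proof. by rewrite divr_ge0 ?addr_ge0. Qed.

Lemma total_presence_le i a s (x : R) T : is_policy a ->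
  sojourn s a i = x%:E -> total a (presence i) T (init s) <= x.
Proof.
move=> aP sx; rewrite -lee_fin -sx /sojourn.
rewrite -[leLHS](_ : (\sum_(0 <= t < T)
  (expect a (presence i) t (init s))%:E)%E = _).
  apply: nneseries_lim_ge => t _ _; rewrite lee_fin.
  by apply: expect_ge0 => // *; exact: presence_ge0.
by rewrite sumEFin big_mkord.
Qed.

(* When the total delay is finite, the presence probability of the packet tends
   to 0 on average, which removes the boundary term of [presence_lower]. *)
Lemma sojourn_ge i a s : is_policy a ->
  (best_delay%:E * enters_prob s a i <= sojourn s a i)%E.
Proof.
move=> aP; have phi0 := phi_ge0 0 (leq0n _).
have := @nneseries_ge0 R (fun t => (expect a (presence i) t (init s))%:E)
  xpredT 0%N.
rewrite -/(sojourn s a i) => s0.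
have {}s0 : (0 <= sojourn s a i)%E.
  apply: s0 => t _ _; rewrite lee_fin.
  by apply: expect_ge0 => // *; exact: presence_ge0.
case sE : (sojourn s a i) s0 => [x| |] // s0; last by rewrite leey.
rewrite muleC -lee_pdivlMr ?best_delay_gt0 //.
apply: ge_ereal_sup => _ [t _ <-]; rewrite -EFinM lee_fin.
rewrite ler_pdivlMr ?best_delay_gt0 // mulrC.
apply/ler_addgt0Pr => e e0.
(* [presence_lower] is averaged over the [n + 1] horizons [t + k]: the boundary terms sum to at most
   a fixed multiple of [x], so their mean drops below [e]. *)
have [n /(_ n (leqnn _)) ne] := inv_succ_small ((1 + phi 0%N) * 2 * x) e e0.
apply: (le_trans _ (_ : x + (1 + phi 0%N) * 2 * x / n.+1%:R <= _)); last first.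
  by rewrite lerD2l.
rewrite -(ler_pM2l (ltr0Sn R n)) mulrDr [X in _ <= _ + X]mulrCA mulfV ?pnatr_eq0 //.
rewrite mulr1.
pose E k := expect a (presence i) (t + k) (init s).
have sumE : \sum_(k < n.+1) E k <= x.
  apply: le_trans (total_presence_le i a s x (t + n.+1) aP sE).
  rewrite /total big_split_ord /= lerDr sumr_ge0 // => k _.
  by apply: expect_ge0 => // *; exact: presence_ge0.
apply: (@le_trans _ _ (\sum_(k < n.+1) (x + (1 + phi 0%N) * 2 * E k))).
  rewrite mulr_natl -[n.+1 in leLHS]card_ord -sumr_const; apply: ler_sum => k _.
  apply: (@le_trans _ _ (best_delay *
      expect a (fun c _ => (i < arr c)%N%:R) (t + k) (init s))).
    by rewrite ler_pM2l ?best_delay_gt0 // expect_arr_le // leq_addr.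
  apply: (le_trans (presence_lower i a _ s aP)).
  by rewrite mulrA lerD2r; apply: total_presence_le.
rewrite big_split /= sumr_const card_ord mulr_natl lerD2l -big_distrr /=.
by rewrite ler_wpM2l // mulr_ge0 // addr_ge0.
Qed.

Lemma enters_prob_bounds i a s : is_policy a -> (0 <= enters_prob s a i <= 1)%E.
Proof.
move=> aP; have bnd t : 0 <= expect a (fun c _ => (i < arr c)%N%:R) t (init s) <= 1.
  by apply: expect_bounded => // c w _; case: (i < arr c)%N; rewrite /= ?lexx ?ler01.
apply/andP; split.
  apply: le_trans (_ : ((expect a (fun c _ => (i < arr c)%N%:R) 0 (init s))%:E <= _)%E).
    by have /andP[+ _] := bnd 0%N; rewrite lee_fin.
  by apply: ereal_sup_ubound; exists 0%N.
by apply: ge_ereal_sup => _ [t _ <-]; have /andP[_] := bnd t; rewrite lee_fin.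
Qed.

(** Otherwise [first_arrival] would give probability zero to every state where decoding is possible,
    and [avgDD] would vanish. *)
Lemma enters_prob_gt0 a s : is_policy a -> (0 < avgDD s a)%E ->
  (0 < enters_prob s a 0)%E.
Proof.
move=> aP DD0; have /andP[p0 p1] := p_bounds.
have [//|e0] := ltP 0%E (enters_prob s a 0); exfalso.
move: DD0; rewrite ltNge => /negP; apply.
apply: ge_ereal_sup => _ [A _ <-]; apply: fsume_le0 => s' _.
have /andP[a0 a1] := aP s'.
have [->|an0] := eqVneq (a s') 0; first by rewrite mule0.
have {a0 an0}ap : 0 < a s' by rewrite lt_def an0.
apply: mule_le0_ge0; last by rewrite lee_fin ltW.
apply: (limn_esup_le _ _ 0%N) => T _; rewrite lee_fin.
rewrite mulr_le0_ge0 ?invr_ge0 // sumr_le0 // => t _.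
have ent : expect a (fun c _ => (0 < arr c)%N%:R) t.+1 (init s) <= 0.
  rewrite -lee_fin; apply: le_trans e0.
  by apply: ereal_sup_ubound; exists t.+1.
have := le_trans (first_arrival a s' t (init s) aP) ent.
by rewrite pmulr_rle0 // mulr_gt0 // subr_gt0.
Qed.

Lemma relay_delay_ge a s : is_policy a -> (0 < avgDD s a)%E ->
  (best_delay%:E <= relay_delay s a)%E.
Proof.
move=> aP DD0; apply: (limn_esup_ge _ _ 0%N) => n _.
have ent i := enters_prob_bounds i a s aP.
have fin i : enters_prob s a i \is a fin_num.
  have /andP[h0 h1] := ent i; rewrite ge0_fin_numE //.
  exact: le_lt_trans h1 (ltry _).
have sE : (\sum_(i < n.+1) enters_prob s a i =
    (\sum_(i < n.+1) fine (enters_prob s a i))%:E)%E.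
  by rewrite -sumEFin; apply: eq_bigr => i _; rewrite fineK.
(* Packet 0 alone keeps the denominator positive. *)
have s0 : 0 < \sum_(i < n.+1) fine (enters_prob s a i).
  rewrite big_ord_recl ltr_pwDl //.
    by rewrite fine_gt0 // enters_prob_gt0 // ltey_eq fin.
  by apply: sumr_ge0 => i _; have /andP[h0 _] := ent (lift ord0 i); rewrite fine_ge0.
rewrite sE inver gt_eqF // lee_pdivlMr // -sE ge0_sume_distrr; last first.
  by move=> i _; have /andP[] := ent i.
by apply: lee_sum => i _; apply: sojourn_ge.
Qed.

(** * Long-run averages and optimality *)

Lemma active_prob_le a s : is_policy a ->
  (active_prob s a <= (tx_period^-1)%:E)%E.
Proof.
move=> aP; have P0 := tx_period_gt0; have wf := well_formed_init s.
set z := (energy (init s))%:R / g + (qd (init s))%:R / (1 - p).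
apply: (limn_esup_le_vanishing _ _ (z / tx_period) 0%N) => T _.
rewrite ler_pdivrMr // mulrDl divfK ?pnatr_eq0 // [_^-1 * _]mulrC -mulrDl.
by rewrite ler_pdivlMr // mulrC; exact: busy_upper.
Qed.

Lemma active_prob_ge0 a s : is_policy a -> (0 <= active_prob s a)%E.
Proof.
move=> aP; apply: (limn_esup_ge _ _ 0%N) => T _; rewrite lee_fin divr_ge0 //.
by apply: sumr_ge0 => t _; apply: expect_ge0.
Qed.

Lemma active_prob_alphaD s : active_prob s (alphaD S) = (tx_period^-1)%:E.
Proof.
apply/eqP; rewrite eq_le (active_prob_le _ s alphaD_policy) /=.
have P0 := tx_period_gt0; have [C hC] := busy_lower.
apply: (limn_esup_ge_vanishing _ _ (C / tx_period)) => T.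
rewrite ler_pdivlMr // mulrBl divfK ?pnatr_eq0 // [_^-1 * _]mulrC -mulrBl.
by rewrite ler_pdivrMr // mulrC; apply: hC.
Qed.

Lemma avg_qd_ge a s y : is_policy a -> active_prob s a = y%:E ->
  ((best_delay * q * y)%:E <= avg_qd s a)%E.
Proof.
move=> aP; have /andP[q0 _] := q_bounds.
apply: (limn_esup_scale_le _ _ _ _ (1 + phi 0%N)) => [|T].
  by rewrite mulr_gt0 // best_delay_gt0.
rewrite mulrA -mulrBl ler_pM2r ?invr_gt0 ?ltr0Sn //.
exact: queue_lower.
Qed.

Lemma avg_qd_alphaD_le s :
  (avg_qd s (alphaD S) <= (best_delay * q / tx_period)%:E)%E.
Proof.
have P0 := tx_period_gt0; have wf := well_formed_init s.
have /andP[q0 _] := q_bounds; have D0 := best_delay_gt0.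
set z := (energy (init s))%:R / g + (qd (init s))%:R / (1 - p).
set d := drained_cost (qd (init s)) (energy (init s)).
apply: (limn_esup_le_vanishing _ _ (best_delay * q * z / tx_period + d) 0%N).
move=> T _; rewrite ler_pdivrMr // mulrDl divfK ?pnatr_eq0 //.
apply: (le_trans (queue_upper T.+1 _ wf)). 
rewrite -/d [leRHS]addrA lerD2r.
rewrite (_ : _ + _ = best_delay * q * (T.+1%:R + z) / tx_period); last by ring.
rewrite ler_pdivlMr // -[leLHS]mulrA ler_pM2l ?mulr_gt0 //.
by rewrite mulrC; apply: busy_upper (alphaD_policy) wf.
Qed.

Lemma alphaD_optimal s : best_delay * p <= 1 -> delay_optimal s (alphaD S).
Proof.
move=> Dp; split=> [|b bP]; first exact: alphaD_policy.
have /andP[p0 _] := p_bounds; have /andP[q0 _] := q_bounds.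
have P0 := tx_period_gt0; have D0 := best_delay_gt0.
have := active_prob_le b s bP; have := active_prob_ge0 b s bP.
case yE : (active_prob s b) => [y| |] //; rewrite !lee_fin => y0 yP.
have th0 x : 0 <= x -> 0 < p + x * q.
  by move=> x0; rewrite ltr_pwDl // mulr_ge0 // ltW.
have P1 : 0 <= tx_period^-1 by rewrite invr_ge0 ltW.
have thy := th0 _ y0; have thP := th0 _ P1.
rewrite /tx_delay /throughput yE active_prob_alphaD -!EFinM -!EFinD.
rewrite !inver !gt_eqF //.
apply: (@le_trans _ _ (((best_delay * q / tx_period)%:E + 1) *
    ((p + tx_period^-1 * q)^-1)%:E)%E).
  rewrite lee_wpmul2r ?lee_fin ?invr_ge0 ?(ltW thP) //.
  by rewrite leeD2r // avg_qd_alphaD_le.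
apply: (@le_trans _ _ (((best_delay * q * y)%:E + 1) *
    ((p + y * q)^-1)%:E)%E); last first.
  rewrite lee_wpmul2r ?lee_fin ?invr_ge0 ?(ltW thy) //.
  by rewrite leeD2r // avg_qd_ge.
rewrite -!EFinD -!EFinM lee_fin ler_pdivrMr // [leRHS]mulrAC ler_pdivlMr //.
(* After cross-multiplication the two sides differ by this product: the bound on the delay is
   nonincreasing in the transmission rate. *)
have : 0 <= (1 - best_delay * p) * (q * (tx_period^-1 - y)).
  by rewrite !mulr_ge0 ?subr_ge0 // ltW.
by lra.
Qed.

End Potentials.

End Dynamics.

(* [D0] is the value of \overline{D_R} as \overline\alpha -> 0, along any
   family [pol] of dynamic policies with positive DD probabilities. *)
Theorem proposition3 (R : realType) (S : relay_system R) (s0 : state S)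
    (pol : nat -> policy S) (D0 : \bar R)
    (b1 : bmax S = 1%N)
    (polP : forall n, is_policy (pol n))
    (DD_gt0 : forall n, (0 < avgDD s0 (pol n))%E)
    (DD_to0 : avgDD s0 (pol n) @[n --> \oo] --> (0 : \bar R))
    (D_to : relay_delay s0 (pol n) @[n --> \oo] --> D0)
    (D0_lt : (D0 < ((detS S)^-1)%:E)%E) :
  delay_optimal s0 (alphaD S).
Proof.
have KN : (0 < txcost S <= ecap S)%N by rewrite txcost_gt0 ltnW ?txcost_lt.
have [phi [phi_low phi_high phi_step phi_ge0]] := attempt_delay_ex _ _ _ _ _
  (harvest_prob_bounds S b1) (detR_prob S) KN.
apply: (alphaD_optimal S b1 phi) => //.
have /andP[p0 _] := detS_prob S.
(* The lower bound on [relay_delay] holds along the whole family and passes to its limit. *)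
have D_le : ((best_delay S phi)%:E <= D0)%E.
  apply: cvge_ge D_to; apply: nearW => n.
  exact: (relay_delay_ge S b1 phi).
have := le_lt_trans D_le D0_lt; rewrite lte_fin => /ltW.
by rewrite -[X in _ <= X]div1r ler_pdivlMr.
Qed.
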